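(* Let $n\ge 2$, let $M>0$, let $G\subsetneq\mathbb{R}^n$ be a convex domain and let $x\in G$. Then the $j$-ball $B_j(x,M)$ of $G$ is convex.
   Context: For a domain $G\subsetneq\mathbb{R}^n$, $n\ge 2$, and $x\in G$ let $d(x)$ denote the Euclidean distance from $x$ to $\partial G$. The $j$-metric on $G$ is $$j_G(x,y)=\log\left(1+\frac{|x-y|}{\min\{d(x),d(y)\}}\right),\qquad x,y\in G.$$ For $x\in G$ and $M>0$ the $j$-ball is $B_j(x,M)=\{y\in G: j_G(x,y)<M\}$. *)

(* Defs.v *)
From HB Require Import structures.
From mathcomp Require Import all_boot all_order all_algebra.
From mathcomp Require Import all_classical all_reals all_analysis.
Set Implicit Arguments.
Unset Strict Implicit.
Unset Printing Implicit Defensive.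
Import Order.TTheory GRing.Theory Num.Theory.
Import numFieldNormedType.Exports.
Local Open Scope classical_set_scope.
Local Open Scope ring_scope.

(** The library norm on ['rV[R]_n] is the sup norm, so the Euclidean norm is
    defined here.  Both norms induce the (product) topology that the library
    puts on ['rV[R]_n], hence [open], [connected], [closure] and [interior]
    have their usual Euclidean meaning. *)
Definition enorm (R : realType) (n : nat) (v : 'rV[R]_n) : R :=
  Num.sqrt (\sum_(i < n) v ord0 i ^+ 2).

Definition boundary (T : topologicalType) (A : set T) : set T :=
  closure A `\` interior A.

Definition domain (T : topologicalType) (G : set T) : Prop :=
  [/\ G !=set0, open G & connected G].

(** [inf] is the junk value [0] on the empty set; a proper domain of ['rV[R]_n]
    has nonempty boundary, so this does not occur for such [G]. *)
Definition bdist (R : realType) (n : nat) (G : set 'rV[R]_n) (x : 'rV[R]_n) : R :=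
  inf [set enorm (x - z) | z in boundary G].

Definition jmetric (R : realType) (n : nat) (G : set 'rV[R]_n)
    (x y : 'rV[R]_n) : R :=
  ln (1 + enorm (x - y) / Num.min (bdist G x) (bdist G y)).

Definition jball (R : realType) (n : nat) (G : set 'rV[R]_n)
    (x : 'rV[R]_n) (M : R) : set 'rV[R]_n :=
  [set y | G y /\ jmetric G x y < M].

(* Main.v *)
Require Import Defs.
From HB Require Import structures.
From mathcomp Require Import all_boot all_order all_algebra.
From mathcomp Require Import all_classical all_reals all_analysis.
From mathcomp Require Import ring lra.
Import Order.TTheory GRing.Theory Num.Theory.
Import numFieldNormedType.Exports.
Local Open Scope classical_set_scope.
Local Open Scope ring_scope.

(** Since [t |-> ln (1 + t)] is increasing, the [j]-ball of radius [M] is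
    [{y in G | |x - y| < c * min (d x) (d y)}] with [c = expR M - 1 > 0]
    ([jballE]).  The distance [d] to the boundary is concave on a convex open
    set ([bdist_concave]), hence so is [y |-> min (d x) (d y)]; the Euclidean
    norm is convex.  Therefore the [j]-ball is a strict sublevel set of the
    convex function [y |-> |x - y| - c * min (d x) (d y)] on the convex set
    [G].

    Concavity of [d] rests on the fact that every point closer to [y] than
    [d y] lies in [G] ([bdist_le_out]), because a segment that leaves [G] meets
    the boundary.  If a boundary point [b] were at distance less than
    [r = t * d y + (1 - t) * d z] from [w = t y + (1 - t) z], then displacing
    [y] and [z] by the vectors [(d y / r) (b - w)] and [(d z / r) (b - w)] would
    give two points of [G] of which [b] is the convex combination with weights
    [t] and [1 - t]; convexity would put [b] in the open set [G], which
    contains none of its boundary points. *)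

(** * The Euclidean norm *)

Lemma enorm_ge0 (R : realType) (n : nat) (v : 'rV[R]_n) : 0 <= enorm v.
Proof. exact: sqrtr_ge0. Qed.

Lemma sumsq_ge0 (R : realType) (n : nat) (v : 'rV[R]_n) :
  0 <= \sum_(i < n) v ord0 i ^+ 2.
Proof. by apply: sumr_ge0 => i _; exact: sqr_ge0. Qed.

Lemma sqr_enorm (R : realType) (n : nat) (v : 'rV[R]_n) :
  enorm v ^+ 2 = \sum_(i < n) v ord0 i ^+ 2.
Proof. by rewrite sqr_sqrtr// sumsq_ge0. Qed.

Lemma enormZ (R : realType) (n : nat) (a : R) (v : 'rV[R]_n) :
  enorm (a *: v) = `|a| * enorm v.
Proof.
rewrite /enorm (eq_bigr (fun i => a ^+ 2 * v ord0 i ^+ 2)); last first.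
  by move=> i _; rewrite mxE exprMn.
by rewrite -mulr_sumr sqrtrM ?sqr_ge0// sqrtr_sqr.
Qed.

Lemma enorm_distC (R : realType) (n : nat) (v w : 'rV[R]_n) :
  enorm (v - w) = enorm (w - v).
Proof. by rewrite -opprB -scaleN1r enormZ normrN1 mul1r. Qed.

Lemma coord_le_enorm (R : realType) (n : nat) (v : 'rV[R]_n) (i : 'I_n) :
  `|v ord0 i| <= enorm v.
Proof.
rewrite -sqrtr_sqr /enorm ler_wsqrtr// (bigD1 i)//= lerDl.
by apply: sumr_ge0 => j _; exact: sqr_ge0.
Qed.

Lemma enorm_eq0 (R : realType) (n : nat) (v : 'rV[R]_n) :
  enorm v = 0 -> v = 0.
Proof.
move=> v0; apply/rowP => i; rewrite mxE; apply/eqP.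
by rewrite -normr_le0 -v0 coord_le_enorm.
Qed.

(** Cauchy-Schwarz, from the nonnegativity of
    [| |w| v - |v| w | ^ 2 = 2 |v| |w| (|v| |w| - <v, w>)]. *)
Lemma dot_le_enorm (R : realType) (n : nat) (v w : 'rV[R]_n) :
  \sum_(i < n) v ord0 i * w ord0 i <= enorm v * enorm w.
Proof.
have [v0|v0] := eqVneq (enorm v) 0.
  rewrite v0 mul0r big1// => i _.
  by rewrite (enorm_eq0 _ _ _ v0) mxE mul0r.
have [w0|w0] := eqVneq (enorm w) 0.
  rewrite w0 mulr0 big1// => i _.
  by rewrite (enorm_eq0 _ _ _ w0) mxE mulr0.
have vw : 0 < enorm v * enorm w.
  by rewrite mulr_gt0// lt_neqAle eq_sym ?v0 ?w0 enorm_ge0.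
have /(le_trans _) := sumsq_ge0 R n (enorm w *: v - enorm v *: w).
move=> /(_ _ (lexx 0)).
rewrite (eq_bigr (fun i => enorm w ^+ 2 * v ord0 i ^+ 2
    - 2 * (enorm v * enorm w) * (v ord0 i * w ord0 i)
    + enorm v ^+ 2 * w ord0 i ^+ 2)); last by move=> i _; rewrite !mxE; ring.
rewrite big_split/= sumrB -!mulr_sumr -!sqr_enorm.
set S := \sum_(i < n) _ => h.
rewrite -(ler_pM2l vw); nra.
Qed.

Lemma enormD (R : realType) (n : nat) (v w : 'rV[R]_n) :
  enorm (v + w) <= enorm v + enorm w.
Proof.
rewrite -(ler_pXn2r (n := 2))// ?nnegrE ?addr_ge0 ?enorm_ge0//.
rewrite sqr_enorm.
rewrite (eq_bigr (fun i => v ord0 i ^+ 2 + 2 * (v ord0 i * w ord0 i)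
    + w ord0 i ^+ 2)); last by move=> i _; rewrite mxE; ring.
rewrite !big_split/= -mulr_sumr -!sqr_enorm.
by have := dot_le_enorm R n v w; nra.
Qed.

Lemma enorm_combination (R : realType) (n : nat) (t : R) (x y z : 'rV[R]_n) :
  0 <= t <= 1 ->
  enorm (x - (t *: y + (1 - t) *: z))
    <= t * enorm (x - y) + (1 - t) * enorm (x - z).
Proof.
move=> /andP[t0 t1].
have -> : x - (t *: y + (1 - t) *: z) = t *: (x - y) + (1 - t) *: (x - z).
  by apply/rowP => i; rewrite !mxE; ring.
by rewrite (le_trans (enormD _ _ _ _))// !enormZ !ger0_norm ?subr_ge0.
Qed.

(** * Distance to the boundary *)

(** Otherwise the parameters of the segment [x, p] at which it lies in [G]
    would form a nonempty, relatively open and relatively closed proper subset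
    of the connected interval [0, 1]. *)
Lemma segment_meets_boundary (R : realType) (n : nat) (G : set 'rV[R]_n)
    (x p : 'rV[R]_n) :
  open G -> G x -> ~ G p ->
  exists2 b, boundary G b & enorm (x - b) <= enorm (x - p).
Proof.
move=> oG Gx nGp; pose f (t : R) : 'rV[R]_n := x + t *: (p - x).
have cf : continuous f.
  move=> t; apply: cvgD; first exact: cvg_cst.
  by apply: cvgZr_tmp; exact: cvg_id.
have f1 : f 1 = p by rewrite /f scale1r addrC subrK.
apply: contrapT => nob.
have nbf t : t \in `[0, 1] -> closure G (f t) -> G (f t).
  rewrite in_itv/= => /andP[t0 t1] clf; apply: contrapT => nGf.
  apply: nob; exists (f t); first by split=> // /interior_subset.
  rewrite /f opprD addNKr -scalerN opprB enormZ ger0_norm//.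
  by rewrite ler_piMl// enorm_ge0.
have fI : `[0, 1] `&` f @^-1` G = `[0, 1]%classic.
  apply: (@segment_connected R 0 1).
  - exists 0; split; first by rewrite /= in_itv/= lexx ler01.
    by rewrite /= /f scale0r addr0.
  - by exists (f @^-1` G) => //; apply: open_comp => // t _; exact: cf.
  - exists (f @^-1` closure G).
      by apply: closed_comp => [t _|]; [exact: cf|exact: closed_closure].
    apply/seteqP; split => t [tI Gt]; split => //; last exact: nbf.
    exact: subset_closure.
have : `[0, 1]%classic (1 : R) by rewrite /= in_itv/= ler01 lexx.
by rewrite -fI => -[_]; rewrite /= f1.
Qed.

Lemma bdist_le_boundary (R : realType) (n : nat) (G : set 'rV[R]_n)
    (x b : 'rV[R]_n) :
  boundary G b -> bdist G x <= enorm (x - b).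
Proof.
move=> bb; apply: ge_inf; last by exists b.
by exists 0 => _ [z _ <-]; exact: enorm_ge0.
Qed.

Lemma bdist_le_out (R : realType) (n : nat) (G : set 'rV[R]_n)
    (x p : 'rV[R]_n) :
  open G -> G x -> ~ G p -> bdist G x <= enorm (x - p).
Proof.
move=> oG Gx nGp.
have [b bb] := segment_meets_boundary _ _ _ _ _ oG Gx nGp.
exact/le_trans/bdist_le_boundary.
Qed.

Lemma le_bdist (R : realType) (n : nat) (G : set 'rV[R]_n)
    (x : 'rV[R]_n) (r : R) :
  boundary G !=set0 -> (forall b, boundary G b -> r <= enorm (x - b)) ->
  r <= bdist G x.
Proof.
move=> [b0 b0b] h; apply: lb_le_inf; first by exists (enorm (x - b0)), b0.
by move=> _ [b bb <-]; exact: h.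
Qed.

(** A sup-norm ball around [x] inside [G] contains the Euclidean ball of the
    same radius. *)
Lemma bdist_gt0 (R : realType) (n : nat) (G : set 'rV[R]_n) (x : 'rV[R]_n) :
  open G -> boundary G !=set0 -> G x -> 0 < bdist G x.
Proof.
move=> oG bG0 Gx.
have /nbhs_ballP[e /= e0 eG] : nbhs x G by exact: open_nbhs_nbhs.
apply: lt_le_trans (e0) _; apply: le_bdist => // b [_ nGb].
rewrite leNgt; apply/negP => xb; apply: nGb.
suff : G b by move: oG => /interior_id ->.
apply: eG; split=> // i j; rewrite ord1 /ball/=.
have := coord_le_enorm R n (x - b) j; rewrite !mxE => h.
exact: le_lt_trans xb.
Qed.

(** The Euclidean balls about [y] and [z] of radii [bdist G y] and [bdist G z]
    lie in [G], hence so does their convex combination, which is the ball about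
    [t y + (1 - t) z] whose radius is the left-hand side. *)
Lemma bdist_concave (R : realType) (n : nat) (G : set 'rV[R]_n) (t : R)
    (y z : 'rV[R]_n) :
  open G -> boundary G !=set0 -> 0 <= t <= 1 ->
  (forall p q, G p -> G q -> G (t *: p + (1 - t) *: q)) ->
  G y -> G z ->
  t * bdist G y + (1 - t) * bdist G z <= bdist G (t *: y + (1 - t) *: z).
Proof.
move=> oG bG0 /andP[t0 t1] cG Gy Gz.
have dy := bdist_gt0 _ _ _ _ oG bG0 Gy; have dz := bdist_gt0 _ _ _ _ oG bG0 Gz.
set r := t * _ + _; set w := t *: y + _.
have r0 : 0 < r by rewrite /r; nra.
apply: le_bdist => // b [_ nGb]; rewrite leNgt; apply/negP => wb; apply: nGb.
have inG p : G p -> G (p + (bdist G p / r) *: (b - w)).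
  move=> Gp; have dp := bdist_gt0 _ _ _ _ oG bG0 Gp.
  apply: contrapT => /(bdist_le_out _ _ _ _ _ oG Gp).
  rewrite opprD addNKr -scalerN opprB enormZ ger0_norm ?divr_ge0 ?(ltW dp) ?(ltW r0)//.
  by rewrite leNgt mulrAC ltr_pdivrMr// ltr_pM2l// wb.
move: oG => /interior_id ->.
set y' := y + (bdist G y / r) *: (b - w).
set z' := z + (bdist G z / r) *: (b - w).
suff -> : b = t *: y' + (1 - t) *: z' by apply: cG; exact: inG.
apply/rowP => i; rewrite /y' /z' /w !mxE.
have rE : t * (bdist G y / r) + (1 - t) * (bdist G z / r) = 1.
  by rewrite !mulrA -mulrDl divff// gt_eqF.
set v := b ord0 i - _.
have -> : b ord0 i = t * y ord0 i + (1 - t) * z ord0 i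
    + (t * (bdist G y / r) + (1 - t) * (bdist G z / r)) * v.
  by rewrite rE /v; ring.
ring.
Qed.

(** * The j-ball *)

Lemma jballE (R : realType) (n : nat) (M : R) (G : set 'rV[R]_n)
    (x y : 'rV[R]_n) :
  open G -> boundary G !=set0 -> G x ->
  jball G x M y <->
  G y /\ enorm (x - y) < (expR M - 1) * Num.min (bdist G x) (bdist G y).
Proof.
move=> oG bG0 Gx.
suff h : G y -> (jmetric G x y < M) =
    (enorm (x - y) < (expR M - 1) * Num.min (bdist G x) (bdist G y)).
  by split=> -[Gy]; rewrite ?h// => lt; split => //; rewrite h.
move=> Gy; rewrite /jmetric; set m := Num.min _ _.
have m0 : 0 < m by rewrite lt_min !bdist_gt0.
have q0 : 0 < 1 + enorm (x - y) / m.
  by rewrite ltr_wpDr// divr_ge0 ?enorm_ge0// ltW.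
by rewrite -{1}[M]expRK ltr_ln ?posrE ?expR_gt0// -ltrBrDl ltr_pdivrMr.
Qed.

Theorem theorem4p5 (R : realType) (n : nat) (hn : (2 <= n)%N)
    (M : R) (hM : 0 < M) (G : set 'rV[R]_n)
    (hdom : domain G) (hproper : G <> setT) (hconv : convex_set G)
    (x : 'rV[R]_n) (hx : G x) :
  convex_set (jball G x M).
Proof.
have [_ oG _] := hdom.
have bG0 : boundary G !=set0.
  have [p nGp] : exists p, ~ G p.
    apply: contrapT => nex; apply: hproper; apply/seteqP; split => // p _.
    by apply: contrapT => nGp; apply: nex; exists p.
  have [b bb _] := segment_meets_boundary _ _ _ _ _ oG hx nGp.
  by exists b.
move=> y z l /set_mem By /set_mem Bz; apply/mem_set; move: By Bz.
have cG p q : G p -> G q -> G (l%:num *: p + (1 - l%:num) *: q).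
  by move=> /mem_set Gp /mem_set Gq; have /set_mem := hconv p q l Gp Gq.
have -> : conv l y z = l%:num *: y + (1 - l%:num) *: z by [].
have l01 : 0 <= l%:num <= 1 by apply/andP; split.
move: (l%:num) l01 cG => t t01 cG.
move=> /(jballE _ _ _ _ _ _ oG bG0 hx) [Gy xy].
move=> /(jballE _ _ _ _ _ _ oG bG0 hx) [Gz xz].
apply/(jballE _ _ _ _ _ _ oG bG0 hx); split; first exact: cG.
apply: le_lt_trans (enorm_combination _ _ _ _ _ _ t01) _.
have c0 : 0 < expR M - 1 by rewrite subr_gt0 expR_gt1.
have min_concave : t * Num.min (bdist G x) (bdist G y)
    + (1 - t) * Num.min (bdist G x) (bdist G z)
    <= Num.min (bdist G x) (bdist G (t *: y + (1 - t) *: z)).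
  case/andP: (t01) => t0 t1.
  rewrite le_min; apply/andP; split.
    have : Num.min (bdist G x) (bdist G y) <= bdist G x by rewrite ge_min lexx.
    have : Num.min (bdist G x) (bdist G z) <= bdist G x by rewrite ge_min lexx.
    by nra.
  apply: le_trans (bdist_concave _ _ _ _ _ _ oG bG0 t01 cG Gy Gz).
  by rewrite lerD// ler_wpM2l ?subr_ge0// ge_min lexx orbT.
apply: lt_le_trans (ler_wpM2l (ltW c0) min_concave).
rewrite mulrDr !(mulrCA (expR M - 1)); case/andP: t01 => t0 t1.
have [->|t_neq0] := eqVneq t 0; first by rewrite !mul0r !add0r subr0 !mul1r.
apply: ltr_leD; first by rewrite ltr_pM2l// lt_neqAle eq_sym t_neq0.
by rewrite ler_wpM2l ?subr_ge0// ltW.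
Qed.
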